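(* Let $L$ be a finite relatively complemented lattice with minimal element $0$ and maximal element $e$, and let $\mu$ be its Möbius function. If $\mu(x,y) \neq 0$ for all $x \le y$ in $L$ with $(x,y) \neq (0,e)$, then $L$ is SSP, i.e. every family $F \subseteq L$ satisfies $|F| \le |\mathrm{Str}(F)|$.
   Context: All posets are finite. The Möbius function of a finite poset is defined for $x \le y$ by $\mu(x,x)=1$ and $\mu(x,y) = -\sum_{z:\, x \le z < y}\mu(x,z)$ for $x<y$. A family (subset) $F \subseteq L$ shatters $y \in L$ if for every $x \le y$ there exists $z \in F$ with $z \wedge y = x$; $\mathrm{Str}(F)$ is the set of all elements of $L$ shattered by $F$. A lattice $L$ is SSP if $|F| \le |\mathrm{Str}(F)|$ for every $F \subseteq L$. $L$ is relatively complemented (RC) if every interval $[x,y]=\{z : x \le z \le y\}$ is a complemented lattice: for every $z \in [x,y]$ there is $w \in [x,y]$ with $z \wedge w = x$ and $z \vee w = y$. *)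

(* Defs.v *)
From mathcomp Require Import all_boot all_order all_algebra.

Set Implicit Arguments.
Unset Strict Implicit.
Unset Printing Implicit Defensive.

Import Order.Theory GRing.Theory.
Local Open Scope order_scope.

(* The recursion defining the Möbius function descends along chains, whose
   length is at most #|P|; the fuel n only serves to make it structural.
   mobiusxx and mobius_lt show that mobius satisfies the usual recurrence.
   Pairs with ~~ (x <= y) get the value 0. *)
Fixpoint mobius_rec (d : Order.disp_t) (P : finPOrderType d) (n : nat)
    (x y : P) : int :=
  if n is m.+1 then
    if x == y then 1%R
    else (- \sum_(z : P | (x <= z)%O && (z < y)%O) mobius_rec m x z)%R
  else 0%R.

Definition mobius (d : Order.disp_t) (P : finPOrderType d) (x y : P) : int :=
  mobius_rec #|P| x y.

Lemma mobius_rec_stable (d : Order.disp_t) (P : finPOrderType d) (n m : nat)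
    (x y : P) :
  (#|[set z : P | (z <= y)%O]| <= n)%N -> (#|[set z : P | (z <= y)%O]| <= m)%N ->
  mobius_rec n x y = mobius_rec m x y.
Proof.
have pos (w : P) : (0 < #|[set z : P | (z <= w)%O]|)%N.
  by apply/card_gt0P; exists w; rewrite inE.
elim: n m x y => [|n IHn] [|m] x y /=; try by rewrite leqNgt pos.
  by move=> _; rewrite leqNgt pos.
move=> len lem; case: eqP => // _; congr (- _)%R.
apply: eq_bigr => z /andP[_ zy].
have lt_card : (#|[set w : P | (w <= z)%O]| < #|[set w : P | (w <= y)%O]|)%N.
  apply/proper_card/properP; split.
    by apply/subsetP => w; rewrite !inE => /le_trans; apply; apply: ltW.
  by exists y; rewrite !inE ?lexx ?lt_geF.
by apply: IHn; rewrite -ltnS; apply: leq_trans lt_card _.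
Qed.

Lemma mobiusxx (d : Order.disp_t) (P : finPOrderType d) (x : P) :
  mobius x x = 1%R.
Proof.
rewrite /mobius; case E: #|P| => [|n] /=; last by rewrite eqxx.
by have := card0_eq E x.
Qed.

Lemma mobius_lt (d : Order.disp_t) (P : finPOrderType d) (x y : P) :
  x < y ->
  mobius x y = (- \sum_(z : P | (x <= z)%O && (z < y)%O) mobius x z)%R.
Proof.
move=> xy; have cardP w : (#|[set z : P | (z <= w)%O]| <= #|P|)%N by apply: max_card.
rewrite {1}/mobius (@mobius_rec_stable _ _ _ #|P|.+1) ?cardP ?leqW //=.
by rewrite lt_eqF.
Qed.

Definition shatters (d : Order.disp_t) (L : finTBLatticeType d)
    (F : {set L}) (y : L) : bool :=
  [forall x : L, (x <= y) ==> [exists z in F, z `&` y == x]].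

Definition Str (d : Order.disp_t) (L : finTBLatticeType d) (F : {set L}) :
    {set L} :=
  [set y | shatters F y].

Definition SSP (d : Order.disp_t) (L : finTBLatticeType d) : Prop :=
  forall F : {set L}, (#|F| <= #|Str F|)%N.

Definition complemented_interval (d : Order.disp_t) (L : finTBLatticeType d)
    (x y : L) : Prop :=
  forall z : L, x <= z <= y ->
    exists w : L, [/\ x <= w <= y, z `&` w = x & z `|` w = y].

Definition relatively_complemented (d : Order.disp_t)
    (L : finTBLatticeType d) : Prop :=
  forall x y : L, x <= y -> complemented_interval x y.

(* Main.v *)
Require Import Defs.
From mathcomp Require Import all_boot all_order all_algebra.

(** Attach to every [w : L] the function [z |-> (w <= z)] on [F].  By Möbius
    inversion, [\sum_(x <= w <= y) mobius x w * (w <= z)] is the indicator of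
    [z `&` y = x].  If [y] is not shattered, some [x <= y] is not of the form
    [z `&` y] with [z \in F], so this combination vanishes on [F]; when
    [mobius x y != 0], it expresses the function of [y] through those of
    smaller elements.  If such an [x] exists for every unshattered [y], the
    functions of the shattered elements span all of them, hence all functions
    on [F] (take [y = \top]), and [#|F| <= #|Str F|]
    ([card_le_Str_of_witness]).

    The hypothesis on [mobius] provides such an [x] unless [y = \top] and
    [x = \bot] is the only element outside [F].  In that case only [\top] fails
    to be shattered: for [y != \top], the meet [\bot] is realised by a
    complement of [y], which is not [\bot] and therefore lies in [F]. *)

Set Implicit Arguments.
Unset Strict Implicit.
Unset Printing Implicit Defensive.

Import Order.Theory GRing.Theory.
Local Open Scope order_scope.

Lemma sum_mobius_interval (d : Order.disp_t) (P : finPOrderType d) (x v : P) :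
  x <= v ->
  (\sum_(w : P | (x <= w)%O && (w <= v)%O) mobius x w)%R = (x == v)%:R%R.
Proof.
rewrite le_eqVlt => /predU1P[<-|xv].
  rewrite eqxx (big_pred1 x) ?mobiusxx // => w /=.
  by rewrite -eq_le eq_sym.
rewrite (bigD1 v) /= ?lexx ?ltW // mobius_lt // lt_eqF //.
rewrite [X in (_ + X)%R](eq_bigl (fun z : P => (x <= z) && (z < v))) ?addNr //.
by move=> w /=; rewrite lt_neqAle -andbA [(w <= v) && _]andbC.
Qed.

(** Möbius inversion on [[x, y]], applied to [z |-> z `&` y]. *)
Lemma sum_mobius_meet (d : Order.disp_t) (L : finTBLatticeType d) (x y z : L) :
  (\sum_(w : L | (x <= w)%O && (w <= y)%O) mobius x w *+ (w <= z)%O)%R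
    = (z `&` y == x)%:R%R.
Proof.
transitivity
  (\sum_(w : L | (x <= w)%O && (w <= z `&` y)%O) mobius x w)%R.
  rewrite [LHS](bigID (fun w : L => w <= z)) /=.
  rewrite [X in (_ + X)%R]big1 ?addr0 => [|w /andP[_ /negPf ->] //].
  apply: eq_big => [w|w /andP[_ ->] //].
  by rewrite lexI -andbA [(w <= y) && _]andbC.
have [xv|xv] := boolP (x <= z `&` y); first by rewrite sum_mobius_interval // eq_sym.
rewrite big_pred0 => [|w]; last first.
  by apply: contraNF xv => /andP[]; apply: le_trans.
by case: eqP xv => // ->; rewrite lexx.
Qed.

(** A system of homogeneous linear equations with fewer equations, indexed by
    [S], than unknowns, indexed by [F], has a nonzero solution. *)
Lemma nonzero_solution (I : finType) (K : fieldType) (F S : {set I})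
    (a : I -> I -> K) : (#|S| < #|F|)%N ->
  exists g : I -> K, (exists2 x, x \in F & g x <> 0%R) /\
    forall w, w \in S -> (\sum_(z in F) g z * a z w = 0)%R.
Proof.
move=> ltSF.
pose A : 'M[K]_(#|F|, #|S|) := (\matrix_(i, j) a (enum_val i) (enum_val j))%R.
have kerA : kermx A != 0%R.
  rewrite kermx_eq0 /row_free neq_ltn.
  by rewrite (leq_ltn_trans (rank_leq_col A) ltSF).
have /rowV0Pn[u /sub_kermxP uA u_neq0] := kerA.
have [i ui] : exists i, u ord0 i != 0%R by apply/rV0Pn.
have xF := enum_valP i.
pose g z := u ord0 (enum_rank_in xF z).
have gE k : g (enum_val k) = u ord0 k by rewrite /g enum_valK_in.
exists g; split; first by exists (enum_val i); rewrite // gE; apply/eqP.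
move=> w wS; have /rowP/(_ (enum_rank_in wS w)) := uA.
rewrite !mxE => uAw; rewrite -[RHS]uAw big_enum_val /=.
by apply: eq_bigr => k _; rewrite gE mxE enum_rankK_in.
Qed.

(** The spanning argument in dual form: a [g] on [F] orthogonal to the functions
    of all shattered elements is orthogonal to those of all elements, hence
    zero. *)
Lemma card_le_Str_of_witness (d : Order.disp_t) (L : finTBLatticeType d)
    (F : {set L}) :
  (forall y : L, ~~ shatters F y ->
     exists x : L, [/\ x <= y, (forall z, z \in F -> z `&` y != x)
                     & mobius x y <> 0%R]) ->
  (#|F| <= #|Str F|)%N.
Proof.
move=> witness; rewrite leqNgt; apply/negP => ltSF.
have [g [[x0 x0F gx0] gS]] :=
  nonzero_solution (fun z w : L => ((w <= z)%O%:R : rat)%R) ltSF.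
have exchange (x y : L) :
    (\sum_(w : L | (x <= w)%O && (w <= y)%O)
       (mobius x w)%:~R * (\sum_(z in F) g z * (w <= z)%O%:R)
     = \sum_(z in F) g z * (z `&` y == x)%O%:R)%R.
  under eq_bigr do rewrite mulr_sumr.
  rewrite exchange_big /=; apply: eq_bigr => z _.
  rewrite -(rmorph_nat intr) -sum_mobius_meet rmorph_sum /= mulr_sumr.
  by apply: eq_bigr => w _; rewrite mulrCA mulr_natr rmorphMn.
have orth (y : L) : (\sum_(z in F) g z * (y <= z)%O%:R = 0)%R.
  have [n] := ubnP #|[set w : L | w <= y]|; elim: n y => // n IHn y yn.
  have [shy|] := boolP (shatters F y); first by apply: gS; rewrite inE.
  move=> /witness[x [xy noz /eqP mu_xy]].
  have := exchange x y; rewrite [RHS]big1 => [|z zF]; last first.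
    by rewrite (negPf (noz z zF)) mulr0.
  rewrite (bigD1 y) ?xy ?lexx //= [X in (_ + X)%R]big1.
    by rewrite addr0 => /eqP; rewrite mulf_eq0 intr_eq0 (negPf mu_xy) => /eqP.
  move=> w /andP[/andP[_ wy] w_neq_y]; rewrite IHn ?mulr0 //.
  rewrite -ltnS; apply: leq_ltn_trans yn.
  apply: proper_card; apply/properP; split.
    by apply/subsetP => v; rewrite !inE => /le_trans; apply.
  by exists y; rewrite !inE ?lexx // lt_geF // lt_neqAle w_neq_y.
apply: gx0; have := exchange x0 \top.
rewrite [LHS]big1 => [|w _]; last by rewrite orth mulr0.
rewrite (bigD1 x0) //= meetx1 eqxx mulr1 big1 ?addr0 => [->//|z /andP[_ zx0]].
by rewrite meetx1 (negPf zx0) mulr0.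
Qed.

Lemma shatters_setC_bot (d : Order.disp_t) (L : finTBLatticeType d) (y : L) :
  relatively_complemented L -> y != \top -> shatters (~: [set \bot]) y.
Proof.
move=> L_RC y_top; apply/forallP => x; apply/implyP => xy; apply/existsP.
have [->|x_bot] := eqVneq x \bot; last first.
  by exists x; rewrite !inE x_bot /=; apply/eqP/meet_idPl.
have [|w [_ yw0 yw1]] := L_RC \bot \top (lex1 _) y; first by rewrite le0x lex1.
exists w; rewrite !inE meetC yw0 eqxx andbT.
by apply: contraNneq y_top => w0; rewrite -yw1 w0 joinx0.
Qed.

Theorem theorem1p5 (d : Order.disp_t) (L : finTBLatticeType d)
    (L_RC : relatively_complemented L)
    (mobius_neq0 : forall x y : L, (x <= y)%O -> (x, y) <> (\bot%O, \top%O) ->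
       mobius x y <> 0%R) :
  SSP L.
Proof.
move=> F; have [->|F_neq] := eqVneq F (~: [set \bot]).
  rewrite cardsC1 -(cardsC1 \top); apply/subset_leq_card/subsetP => y.
  by rewrite !inE => y_top; apply: shatters_setC_bot.
apply: card_le_Str_of_witness => y /forallPn[x].
rewrite negb_imply => /andP[xy /existsPn noz].
have nozx z : z \in F -> z `&` y != x by move=> zF; have := noz z; rewrite zF.
have [[x0 y1]|/eqP xy01] := eqVneq (x, y) (\bot, \top); last first.
  by exists x; split=> //; apply: mobius_neq0.
(* Here x = \bot is missing from F; as F is not the complement of \bot, some
   x' <> \bot is missing too, and it can be used instead. *)
have F0 : \bot \notin F.
  by apply/negP => /nozx; rewrite y1 x0 meetx1 eqxx.
have [x' x'0 x'F] : exists2 x' : L, x' != \bot & x' \notin F.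
  apply/exists_inP; apply: contraNT F_neq => /exists_inPn allF.
  apply/eqP/setP => z; rewrite !inE; have [->|/allF] := eqVneq z \bot.
    exact: negPf.
  by rewrite negbK.
exists x'; rewrite y1; split; first exact: lex1.
  by move=> z zF; rewrite meetx1; apply: contraNneq x'F => <-.
by apply: mobius_neq0; [exact: lex1 | case=> /eqP; rewrite (negPf x'0)].
Qed.
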